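(* Let $B$ be a monomial ideal of $S$ and let $B_1,\dots,B_t$ be monomial ideals of $S$ with $\mathbb{V}(B)=\bigcup_{i=1}^t\mathbb{V}(B_i)$. For $\emptyset\ne I\subseteq[t]=\{1,\dots,t\}$ let $B_I=\sum_{i\in I}B_i$. Let $M$ be a $G$-graded $S$-module. For each $i\ge0$, $$\bigcap_{p\ge0}\ \bigcap_{\substack{I\subseteq[t]\\ \#I=p+1}}\mathcal{Z}^{i+p}_{B_I}(M)\subseteq\mathcal{Z}^i_B(M).$$
   Context: $R$ is a commutative Noetherian ring, $G$ is a finitely generated abelian group, and $S=R[x_1,\dots,x_n]$ is a $G$-graded polynomial $R$-algebra (each $x_i$ homogeneous, $R$ in degree $\mathbf 0$). $\mathbb{V}(\cdot)$ denotes the closed subset of $\mathrm{Spec}(S)$ defined by an ideal; thus $\mathbb{V}(B_I)=\bigcap_{i\in I}\mathbb{V}(B_i)$. For a $G$-graded ideal $A\subset S$, $\mathcal{Z}^i_A(M)=\{\mathbf{p}\in G:H^i_A(M)_{\mathbf{p}}=0\}$, where $H^i_A(M)$ is the $G$-graded local cohomology. *)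

(* Defs.v *)
From HB Require Import structures.
From mathcomp Require Import all_boot all_order all_algebra.
From mathcomp Require Import boolp classical_sets functions.
From mathcomp Require Import mpoly.

Set Implicit Arguments.
Unset Strict Implicit.
Unset Printing Implicit Defensive.

Import GRing.Theory.

Local Open Scope classical_set_scope.
Local Open Scope quotient_scope.
Local Open Scope ring_scope.

Section Ideals.
Context (A : comNzRingType).
Implicit Types (I P X : set A).

Definition is_ideal I : Prop :=
  [/\ I 0, forall a b, I a -> I b -> I (a + b) & forall r a, I a -> I (r * a)].

Definition ideal_gen X : set A := smallest is_ideal X.

Lemma ideal_gen_ideal X : is_ideal (ideal_gen X).
Proof.
split=> [I [[]] //|a b Xa Xb I IX|r a Xa I IX]; case: (IX) => -[_ ID IZ] _.
  by apply: (ID); [exact: Xa | exact: Xb].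
by apply: (IZ); exact: Xa.
Qed.

Definition noetherian : Prop :=
  forall I, is_ideal I -> exists s : seq A, I = ideal_gen [set` s].

Definition ideal_exp I (k : nat) : set A :=
  ideal_gen [set \prod_(a <- s) a
            | s in [set s : seq A | size s = k /\ forall a, a \in s -> I a]].

Definition ideal_sum (t : nat) (B : 'I_t -> set A) (J : {set 'I_t}) : set A :=
  [set \sum_(j in J) b j
  | b in [set b : 'I_t -> A | forall j, j \in J -> B j (b j)]].

Definition is_prime P : Prop :=
  [/\ is_ideal P, ~ P 1 & forall a b, P (a * b) -> P a \/ P b].

(* The closed subset V(I) of the spectrum, as a set of prime ideals. *)
Definition vanishing I : set (set A) := [set P | is_prime P /\ I `<=` P].

End Ideals.

Definition fin_gen_group (G : zmodType) : Prop :=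
  exists s : seq G, forall g, exists c : G -> int, g = \sum_(h <- s) h *~ c h.

Definition is_monomial_ideal (n : nat) (R : comNzRingType)
    (I : set {mpoly R[n]}) : Prop :=
  exists X : set 'X_{1..n}, I = ideal_gen [set 'X_[R, m] | m in X].

Section Graded.
Context (R : comNzRingType) (n : nat) (G : zmodType) (d : 'I_n -> G).
Local Notation S := {mpoly R[n]}.

(* [d j] is the degree of the j-th variable; constants have degree 0. *)
Definition mnm_deg (m : 'X_{1..n}) : G := \sum_(j < n) d j *+ m j.

Definition poly_part (g : G) : set S :=
  [set s | forall m, m \in msupp s -> mnm_deg m = g].

Record grmod := GrMod {
  gr_car :> lmodType S;
  gr_part : G -> set gr_car;
  gr_part0 : forall g, gr_part g 0;
  gr_partB : forall g x y, gr_part g x -> gr_part g y -> gr_part g (x - y);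
  gr_partZ : forall h g s x,
    poly_part h s -> gr_part g x -> gr_part (h + g) (s *: x);
  gr_span : forall x, exists (s : seq G) (c : G -> gr_car),
    [/\ uniq s, forall g, gr_part g (c g) & x = \sum_(g <- s) c g];
  gr_direct : forall (s : seq G) (c : G -> gr_car),
    uniq s -> (forall g, gr_part g (c g)) -> \sum_(g <- s) c g = 0 ->
    forall g, g \in s -> c g = 0
}.

(* Morphisms of graded modules: S-linear maps of degree 0. *)
Record grhom (M N : grmod) := GrHom {
  gr_fun :> {linear M -> N};
  gr_fun_part : forall g x, gr_part g x -> gr_part g (gr_fun x)
}.

Definition gr_injective (E : grmod) : Prop :=
  forall (A B : grmod) (i : grhom A B) (f : grhom A E), injective i ->
  exists h : grhom B E, forall a, h (i a) = f a.

Record inj_resolution (M : grmod) := InjResolution {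
  ir_mod : nat -> grmod;
  ir_aug : grhom M (ir_mod 0);
  ir_diff : forall k, grhom (ir_mod k) (ir_mod k.+1);
  ir_injective : forall k, gr_injective (ir_mod k);
  ir_aug_inj : injective ir_aug;
  ir_exact0 : forall x, ir_diff 0 x = 0 <-> exists y, x = ir_aug y;
  ir_exactS : forall k x, ir_diff k.+1 x = 0 <-> exists y, x = ir_diff k y
}.

End Graded.

(* Graded modules have enough injectives: the injective objects used are the
   graded modules coinduced from powers of Q/Z. *)

Section Extension.
Context (B D : zmodType).
Context (divD : forall (y : D) k, (0 < k)%N -> exists z, z *+ k = y).

Definition addgraph (T : set (B * D)) : Prop :=
  [/\ T (0, 0),
      forall a b y z, T (a, y) -> T (b, z) -> T (a - b, y - z)
    & forall y, T (0, y) -> y = 0].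

Lemma addgraph_mulrn T a y k :
  addgraph T -> T (a, y) -> T (a *+ k, y *+ k).
Proof.
case=> T0 TB _ Ta; elim: k => [|k IH]; first by rewrite !mulr0n.
have -> : (a *+ k.+1, y *+ k.+1) = (a - (0 - a *+ k), y - (0 - y *+ k)).
  by rewrite !sub0r !opprK !mulrS.
by apply: (TB) => //; apply: (TB).
Qed.

Lemma addgraph_mulrz T a y (k : int) :
  addgraph T -> T (a, y) -> T (a *~ k, y *~ k).
Proof.
move=> gT Ta; case: (gT) => T0 TB _; case: k => k.
  by rewrite -!pmulrn; exact: addgraph_mulrn.
rewrite NegzE !mulrNz -[- (a *~ _)]add0r -[- (y *~ _)]add0r.
by apply: (TB) => //; rewrite -!pmulrn; exact: addgraph_mulrn.
Qed.

Definition addgraph_adjoin (T : set (B * D)) (b : B) (y : D) : set (B * D) :=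
  [set u | exists k : int, T (u.1 - b *~ k, u.2 - y *~ k)].

Let subrACA (V : zmodType) (p q r s : V) : p - q - (r - s) = p - r - (q - s).
Proof. by rewrite !opprD addrACA. Qed.

Lemma addgraph_adjoinP T b y : addgraph T ->
  (forall (k : int) z, T (b *~ k, z) -> z = y *~ k) ->
  addgraph (addgraph_adjoin T b y).
Proof.
move=> [T0 TB Tf] Hy; split.
- by exists 0; rewrite !mulr0z !subr0.
- move=> a c u v [k Tk] [l Tl]; exists (k - l) => /=.
  by rewrite !mulrzBr -(subrACA a) -(subrACA u); exact: TB Tk Tl.
- move=> z [k /=]; rewrite sub0r -mulrNz => /Hy; rewrite mulrNz => E.
  by rewrite -[z](subrK (y *~ k)) E addNr.
Qed.

Lemma sub_addgraph_adjoin T b y : T `<=` addgraph_adjoin T b y.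
Proof. by move=> [a z] Ta; exists 0; rewrite !mulr0z !subr0. Qed.

Lemma addgraph_adjoin_mem T b y : addgraph T -> addgraph_adjoin T b y (b, y).
Proof. by case=> T0 _ _; exists 1; rewrite /= !mulr1z !subrr. Qed.

(* Either no nonzero multiple of [b] is in the domain of [T], or they are the
   multiples of a least positive one. *)
Lemma addgraph_dom T b : addgraph T ->
  (forall (l : int) w, T (b *~ l, w) -> l = 0 /\ w = 0) \/
  exists2 k : nat, (0 < k)%N & exists2 z, T (b *+ k, z) &
    forall (l : int) w, T (b *~ l, w) ->
      exists q : int, l = q * k%:Z /\ w = z *~ q.
Proof.
move=> gT; case: (gT) => T0 TB Tf.
pose p k := `[< (0 < k)%N /\ exists z, T (b *+ k, z) >].
have [pk|np] := pselect (exists k, p k); last first.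
  left=> l w Tl; have [l0|l0] := eqVneq l 0.
    by move: Tl; rewrite l0 mulr0z => /Tf.
  case: np; case: l l0 Tl => k k0 Tk; [exists k|exists k.+1]; apply/asboolP.
    by split; [rewrite lt0n | exists w; rewrite pmulrn].
  split=> //; exists (- w); have := addgraph_mulrz (-1) gT Tk.
  by rewrite NegzE mulrNz !mulrN1z opprK -pmulrn.
have [k /asboolP[k0 [z Tk]] kmin] := ex_minnP pk.
right; exists k => //; exists z => // l w Tl; exists (l %/ k)%Z.
have Tr : T (b *~ (l %% k)%Z, w - z *~ (l %/ k)%Z).
  have := TB _ _ _ _ Tl (addgraph_mulrz (l %/ k)%Z gT Tk).
  by rewrite pmulrn -mulrzA -mulrzBr {1}(divz_eq l k) mulrC addrAC subrr add0r.
have kz : k%:Z != 0 by rewrite -lt0n.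
have r0 : (l %% k)%Z = 0.
  move: Tr (modz_ge0 l kz) (@ltz_pmod l k); case: (l %% k)%Z => // -[|j] // Tr _.
  rewrite !ltz_nat => /(_ k0); rewrite ltnNge => /negP[]; apply: kmin.
  by apply/asboolP; split => //; exists (w - z *~ (l %/ k)%Z); rewrite pmulrn.
move: Tr; rewrite r0 mulr0z => /Tf /eqP; rewrite subr_eq0 => /eqP ->; split=> //.
by rewrite {1}(divz_eq l k) r0 addr0.
Qed.

Lemma addgraph_extend T b : addgraph T ->
  exists y, addgraph (addgraph_adjoin T b y).
Proof.
move=> gT; have [free|[k k0 [z Tk per]]] := addgraph_dom b gT.
  exists 0; apply: addgraph_adjoinP => // l w Tl.
  by have [-> ->] := free _ _ Tl; rewrite mulr0z.
have [y yk] := divD z k0; exists y; apply: addgraph_adjoinP => // l w Tl.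
by have [q [-> ->]] := per _ _ Tl; rewrite mulrC mulrzA -pmulrn yk.
Qed.

Lemma addgraph_total T : addgraph T ->
  exists f : {additive B -> D}, forall a y, T (a, y) -> f a = y.
Proof.
move=> gT; pose P U := U = set0 \/ (T `<=` U /\ addgraph U).
have [|U [[U0|[TU gU]] Umax]] := @Zorn_bigcup _ P.
- move=> F FP Ftot.
  have [[V FV V0]|F0] := pselect (exists2 V, F V & V !=set0); last first.
    left; apply/seteqP; split=> // u [V FV Vu].
    by case: F0; exists V => //; exists u.
  right; have [TV [V0' _ _]] : T `<=` V /\ addgraph V.
    by case: (FP _ FV) => // V0'; case: V0 => u; rewrite V0'.
  split; first by move=> u /TV Vu; exists V.
  split; first by exists V.
  + move=> a b y z [V1 F1 V1a] [V2 F2 V2b].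
    have [V3 [F3 V3a V3b]] : exists V3, [/\ F V3, V3 (a, y) & V3 (b, z)].
      by case: (Ftot _ _ F1 F2) => s; [exists V2|exists V1]; split=> //; apply: s.
    exists V3 => //; case: (FP _ F3) => [V3E|[_ [_ VB _]]]; last exact: VB.
    by rewrite V3E in V3a.
  + move=> y [V1 F1 V1y]; case: (FP _ F1) => [V1E|[_ [_ _ Vf]]]; last exact: Vf.
    by rewrite V1E in V1y.
- case: (gT) => T0 _ _; exfalso.
  apply: (Umax T); last by right; split.
  by rewrite U0; split => // sub; exact: (sub _ T0).
have tot b : exists y, U (b, y).
  have [y gy] := addgraph_extend b gU; exists y; apply: contrapT => nU.
  apply: (Umax (addgraph_adjoin U b y)); last first.
    by right; split=> // u /TU; exact: sub_addgraph_adjoin.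
  split; first exact: sub_addgraph_adjoin.
  by move=> sub; apply: nU; apply: sub; exact: addgraph_adjoin_mem.
have [f fP] := choice tot; case: gU => U0 UB Uf.
have f_add : zmod_morphism f.
  move=> a b; apply/eqP; rewrite -subr_eq0; apply/eqP; apply: Uf.
  by rewrite -(subrr (a - b)); apply: (UB) => //; exact: (UB).
pose fL := GRing.isZmodMorphism.Build B D f f_add.
pose F : {additive B -> D} := HB.pack f fL.
exists F => a y /TU Uy; apply/eqP; rewrite -subr_eq0; apply/eqP; apply: Uf.
by rewrite -(subrr a); exact: UB.
Qed.

End Extension.
Definition rat_int : {pred rat} := fun q => `[< exists k : int, q = k%:~R >].

Lemma rat_int_zmod_closed : zmod_closed rat_int.
Proof.
split; first by apply/asboolP; exists 0.
move=> x y /asboolP[k ->] /asboolP[l ->]; apply/asboolP; exists (k - l).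
by rewrite intrB.
Qed.
HB.instance Definition _ :=
  GRing.isZmodClosed.Build rat rat_int rat_int_zmod_closed.

Definition QZ : zmodType := Quotient.quot rat_int.

Lemma QZ_pi_mulrn (q : rat) k :
  (\pi_(Quotient.quot rat_int) q : QZ) *+ k = \pi_(Quotient.quot rat_int) (q *+ k).
Proof.
elim: k => [|k IH]; first by rewrite !mulr0n piE.
by rewrite !mulrS IH !piE.
Qed.

Lemma QZ_divisible (y : QZ) k : (0 < k)%N -> exists z : QZ, z *+ k = y.
Proof.
move=> k0; rewrite -[y]reprK.
exists (\pi_(Quotient.quot rat_int) (repr y / k%:R)).
rewrite QZ_pi_mulrn -(mulr_natr (_ / _)) mulfVK //.
by rewrite Num.Theory.pnatr_eq0 -lt0n.
Qed.

Lemma QZ_torsion k : (1 < k)%N -> exists2 y : QZ, y != 0 & y *+ k = 0.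
Proof.
move=> k1; have k0 : k%:R != 0 :> rat.
  by rewrite Num.Theory.pnatr_eq0 -lt0n ltnW.
have piE0 q : (\pi_(Quotient.quot rat_int) q == 0 :> QZ) = (q \in rat_int).
  have -> : 0 = \pi_(Quotient.quot rat_int) 0 :> QZ by rewrite piE.
  by rewrite -Quotient.idealrBE subr0.
exists (\pi_(Quotient.quot rat_int) k%:R^-1).
  rewrite piE0; apply/negP => /asboolP[l lk].
  have : (l * k%:Z)%:~R = 1%:~R :> rat by rewrite intrM -lk mulVf.
  move=> /intr_inj lk1; have : (k%:Z %| 1)%Z by apply/dvdzP; exists l.
  by rewrite dvdz1 /= => /eqP k1'; rewrite k1' in k1.
apply/eqP; rewrite QZ_pi_mulrn piE0 -(mulr_natl (_^-1)) mulfV //.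
by apply/asboolP; exists 1.
Qed.

Lemma QZ_separates (B : zmodType) (K : set B) (a : B) :
  K 0 -> (forall b c, K b -> K c -> K (b - c)) -> ~ K a ->
  exists2 f : {additive B -> QZ}, (forall b, K b -> f b = 0) & f a != 0.
Proof.
move=> K0 KB nKa; pose T : set (B * QZ) := [set u | K u.1 /\ u.2 = 0].
have gT : addgraph T.
  split=> [|b c y z [/= Kb ->] [/= Kc ->]|y []] //.
  by split=> /=; [exact: KB | rewrite subr0].
suff [y y0 yP] : exists2 y : QZ, y != 0 &
    forall (k : int) z, T (a *~ k, z) -> z = y *~ k.
  have [f fP] := addgraph_total QZ_divisible (addgraph_adjoinP gT yP).
  exists f => [b Kb|]; first by apply/fP/sub_addgraph_adjoin.
  by rewrite (fP _ _ (addgraph_adjoin_mem _ _ gT)).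
have [free|[k k0 [z Tk per]]] := addgraph_dom a gT.
  have [y y0 _] := QZ_torsion (isT : (1 < 2)%N); exists y => // l w Tl.
  by have [-> ->] := free _ _ Tl; rewrite mulr0z.
have k1 : (1 < k)%N.
  by case: k k0 Tk {per} => [|[|k]] // _ []; rewrite /= mulr1n.
have [y y0 yk] := QZ_torsion k1; exists y => // l w Tl.
have [q [-> ->]] := per _ _ Tl; case: Tk => _ /= ->.
by rewrite mulrC mulrzA -pmulrn yk.
Qed.
Section Components.
Context (R : comNzRingType) (n : nat) (G : zmodType) (d : 'I_n -> G).
Local Notation S := {mpoly R[n]}.
Local Notation grmod := (grmod R d).

Lemma big_subseq_if (V : nmodType) (s u : seq G) (c : G -> V) :
  uniq s -> uniq u -> {subset s <= u} ->
  \sum_(g <- u) (if g \in s then c g else 0) = \sum_(g <- s) c g.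
Proof.
move=> us uu su; rewrite -big_mkcond -big_filter; apply: perm_big.
apply: uniq_perm; rewrite ?filter_uniq // => g; rewrite mem_filter.
by apply/andP/idP => [[]//|gs]; split=> //; exact: su.
Qed.

Lemma mnm_deg0 : mnm_deg d 0%MM = 0.
Proof. by rewrite /mnm_deg big1 // => j _; rewrite mnm0E mulr0n. Qed.

Lemma mnm_degD m p : mnm_deg d (m + p)%MM = mnm_deg d m + mnm_deg d p.
Proof.
by rewrite /mnm_deg -big_split; apply: eq_bigr => j _; rewrite mnmDE mulrnDr.
Qed.

Lemma poly_part1 : poly_part d 0 (1 : S).
Proof. by move=> m; rewrite msupp1 inE => /eqP ->; exact: mnm_deg0. Qed.

Lemma poly_part_monomial (c : R) m :
  poly_part d (mnm_deg d m) (c *: 'X_[m]).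
Proof. by move=> p /msuppZ_le; rewrite msuppX inE => /eqP ->. Qed.

Lemma poly_partM h k (s t : S) :
  poly_part d h s -> poly_part d k t -> poly_part d (h + k) (s * t).
Proof.
move=> hs kt m /msuppM_le /allpairsP[[p q] [/= ps qt ->]].
by rewrite mnm_degD (hs _ ps) (kt _ qt).
Qed.

Section OneModule.
Context (M : grmod).
Implicit Types (x y : M) (g h : G).

Lemma gr_partD g x y : gr_part g x -> gr_part g y -> gr_part g (x + y).
Proof.
move=> gx gy; rewrite -[y]opprK; apply: gr_partB => //.
by rewrite -sub0r; apply: gr_partB => //; exact: gr_part0.
Qed.

Lemma gcomp_exists x : exists c : G -> M,
  (forall g, gr_part g (c g)) /\
  exists2 s : seq G, uniq s &
    (forall g, g \notin s -> c g = 0) /\ x = \sum_(g <- s) c g.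
Proof.
have [s [c [us cP ->]]] := gr_span x.
exists (fun g => if g \in s then c g else 0); split=> [g|].
  by case: ifP => // _; exact: gr_part0.
exists s => //; split=> [g /negPf -> //|].
by rewrite [RHS]big_subseq_if.
Qed.

Definition gcomp g x : M := projT1 (cid (gcomp_exists x)) g.

Lemma gcomp_part g x : gr_part g (gcomp g x).
Proof. by rewrite /gcomp; case: cid => c []. Qed.

Lemma gcomp_sum x : exists2 s : seq G, uniq s &
  (forall g, g \notin s -> gcomp g x = 0) /\ x = \sum_(g <- s) gcomp g x.
Proof. by rewrite /gcomp; case: cid => c []. Qed.

Lemma gcomp_unique (s : seq G) (c : G -> M) : uniq s ->
  (forall g, gr_part g (c g)) -> (forall g, g \notin s -> c g = 0) ->
  forall g, gcomp g (\sum_(h <- s) c h) = c g.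
Proof.
move=> us cP cs g; set x := \sum_(h <- s) c h.
have [t ut [xt xE]] := gcomp_sum x.
have uu := undup_uniq (s ++ t); set u := undup _ in uu.
have ext (r : seq G) (e : G -> M) : uniq r -> {subset r <= u} ->
    (forall g, g \notin r -> e g = 0) -> \sum_(h <- r) e h = \sum_(h <- u) e h.
  move=> ur ru er; rewrite -(big_subseq_if e ur uu ru); apply: eq_bigr => h _.
  by case: ifP => // /negbT /er.
have su : {subset s <= u} by move=> h hs; rewrite mem_undup mem_cat hs.
have tu : {subset t <= u} by move=> h ht; rewrite mem_undup mem_cat ht orbT.
have [gu|gu] := boolP (g \in u); last first.
  by rewrite xt ?cs //; apply: contra gu => gr; rewrite mem_undup mem_cat gr ?orbT.
apply/eqP; rewrite -subr_eq0; apply/eqP.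
apply: (@gr_direct _ _ _ _ M u (fun g => gcomp g x - c g)) => // [h|].
  by apply: gr_partB => //; exact: gcomp_part.
by rewrite sumrB -(ext _ _ ut tu xt) -(ext _ _ us su cs) -xE subrr.
Qed.

Lemma gcompB g : {morph gcomp g : x y / x - y}.
Proof.
move=> x y; have [s us [xs xE]] := gcomp_sum x.
have [t ut [yt yE]] := gcomp_sum y.
have uu := undup_uniq (s ++ t); set u := undup _ in uu.
have ext (r : seq G) (e : G -> M) : uniq r -> {subset r <= u} ->
    (forall g, g \notin r -> e g = 0) -> \sum_(h <- r) e h = \sum_(h <- u) e h.
  move=> ur ru er; rewrite -(big_subseq_if e ur uu ru); apply: eq_bigr => h _.
  by case: ifP => // /negbT /er.
have su : {subset s <= u} by move=> h hs; rewrite mem_undup mem_cat hs.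
have tu : {subset t <= u} by move=> h ht; rewrite mem_undup mem_cat ht orbT.
rewrite {1}xE {1}yE (ext _ _ us su xs) (ext _ _ ut tu yt) -sumrB.
rewrite (@gcomp_unique _ (fun h => gcomp h x - gcomp h y)) // => h.
  by apply: gr_partB; exact: gcomp_part.
by rewrite mem_undup mem_cat negb_or => /andP[/xs -> /yt ->]; rewrite subr0.
Qed.

Lemma gcomp_id g x : gr_part g x -> gcomp g x = x.
Proof.
move=> gx; have := @gcomp_unique [:: g] (fun h => if h == g then x else 0).
rewrite big_seq1 eqxx => -> //; first by rewrite eqxx.
  by move=> h; case: eqP => [->//|_]; exact: gr_part0.
by move=> h; rewrite inE => /negPf ->.
Qed.

Lemma gcomp_neq g h x : gr_part h x -> h != g -> gcomp g x = 0.
Proof.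
move=> hx hg; have := @gcomp_unique [:: h] (fun k => if k == h then x else 0).
rewrite big_seq1 eqxx => -> //; first by rewrite eq_sym (negPf hg).
  by move=> k; case: eqP => [->//|_]; exact: gr_part0.
by move=> k; rewrite inE => /negPf ->.
Qed.

Lemma gcomp_additive (V : zmodType) (L : {additive M -> V}) g :
  (forall h x, gr_part h x -> h != g -> L x = 0) ->
  forall x, L (gcomp g x) = L x.
Proof.
move=> L0 x; have [s us [xs xE]] := gcomp_sum x; rewrite [in RHS]xE raddf_sum.
have [gs|gs] := boolP (g \in s).
  rewrite (bigD1_seq g) //= big1 ?addr0 // => h hg.
  exact: L0 (gcomp_part h x) hg.
rewrite xs // raddf0 big_seq big1 // => h hs; apply: L0 (gcomp_part h x) _.
by apply: contraNneq gs => <-.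
Qed.

End OneModule.

Lemma grhom_gcomp (M N : grmod) (f : grhom M N) g x :
  f (gcomp g x) = gcomp g (f x).
Proof.
have [s us [xs xE]] := gcomp_sum x.
rewrite [in RHS]xE raddf_sum (@gcomp_unique _ _ (fun h => f (gcomp h x))) //.
  by move=> h; apply: gr_fun_part; exact: gcomp_part.
by move=> h /xs ->; rewrite raddf0.
Qed.

End Components.
Section Coinduced.
Context (R : comNzRingType) (n : nat) (G : zmodType) (d : 'I_n -> G).
Context (D : zmodType) (X : Type).
Local Notation S := {mpoly R[n]}.
Local Notation F := (S -> G -> X -> D).

(* In degree h: families, indexed by g in G and X, of additive maps S -> D
   supported in degree g - h. *)
Definition coind_part (h : G) : set F :=
  [set f | (forall s t, f (s - t) = f s - f t) /\
           forall k s g x, poly_part d k s -> k + h != g -> f s g x = 0].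

Definition coind_mem : {pred F} := fun f =>
  `[< exists (s : seq G) (c : G -> F),
      [/\ uniq s, forall g, coind_part g (c g) & f = \sum_(g <- s) c g] >].

Let sum_evalE (I : Type) (r : seq I) (c : I -> F) s :
  (\sum_(i <- r) c i) s = \sum_(i <- r) c i s.
Proof. by rewrite fct_sumE. Qed.

Lemma coind_part0 h : coind_part h 0.
Proof. by split=> // s t; rewrite subr0. Qed.

Lemma coind_partB h e f :
  coind_part h e -> coind_part h f -> coind_part h (e - f).
Proof.
move=> [eB e0] [fB f0]; split=> [s t|k s g x ks kh].
  rewrite -[LHS]/(e (s - t) - f (s - t)) eB fB !opprD addrACA.
  by [].
by rewrite -[LHS]/(e s g x - f s g x) (e0 k) ?(f0 k) ?subr0.
Qed.

Lemma coind_mem_zmod_closed : zmod_closed coind_mem.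
Proof.
split=> [|e f /asboolP[s [b [us bP ->]]] /asboolP[t [c [ut cP ->]]]].
  apply/asboolP; exists [::], (fun=> 0); split=> //; last by rewrite big_nil.
  by move=> g; exact: coind_part0.
have uu := undup_uniq (s ++ t); set u := undup _ in uu.
have su : {subset s <= u} by move=> h hs; rewrite mem_undup mem_cat hs.
have tu : {subset t <= u} by move=> h ht; rewrite mem_undup mem_cat ht orbT.
apply/asboolP; exists u.
exists (fun g => (if g \in s then b g else 0) - (if g \in t then c g else 0)).
split=> // [g|]; last by rewrite sumrB !big_subseq_if.
by apply: coind_partB; case: ifP => // _; exact: coind_part0.
Qed.
HB.instance Definition _ :=
  GRing.isZmodClosed.Build F coind_mem coind_mem_zmod_closed.

Lemma coind_part_mem h f : coind_part h f -> f \in coind_mem.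
Proof.
move=> hf; apply/asboolP; exists [:: h], (fun g => if g == h then f else 0).
split=> // [g|]; last by rewrite big_seq1 eqxx.
by case: eqP => [->|_] //; exact: coind_part0.
Qed.

Lemma coind_memB f s t : f \in coind_mem -> f (s - t) = f s - f t.
Proof.
move=> /asboolP[u [c [_ cP ->]]]; rewrite !sum_evalE -sumrB.
by apply: eq_bigr => g _; case: (cP g).
Qed.

Lemma coind_mem_sum f (I : Type) (r : seq I) (a : I -> S) :
  f \in coind_mem -> f (\sum_(i <- r) a i) = \sum_(i <- r) f (a i).
Proof.
move=> fP; have f0 : f 0 = 0 by rewrite -[X in f X](subrr 0) coind_memB ?subrr.
have fN t : f (- t) = - f t by rewrite -[X in f X]sub0r coind_memB // f0 sub0r.
have fD s t : f (s + t) = f s + f t.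
  by rewrite -[X in f (_ + X)]opprK coind_memB // fN opprK.
exact: (big_morph f fD f0).
Qed.

Definition coind_scale (r : S) (f : F) : F := fun s => f (s * r).

Lemma coind_part_scale k h r f : poly_part d k r -> coind_part h f ->
  coind_part (k + h) (coind_scale r f).
Proof.
move=> kr [fB f0]; split=> [s t|l s g x ls lh].
  by rewrite /coind_scale mulrBl fB.
by apply: (f0 (l + k)); rewrite -?addrA //; exact: poly_partM.
Qed.

Lemma coind_scale_mem r f : f \in coind_mem -> coind_scale r f \in coind_mem.
Proof.
move=> fP.
have -> : coind_scale r f =
    \sum_(m <- msupp r) coind_scale (r@_m *: 'X_[m]) f.
  apply/funext => s; rewrite sum_evalE -coind_mem_sum //.
  by rewrite -mulr_sumr -mpolyE.
apply: rpred_sum => m _; move: fP => /asboolP[u [c [_ cP ->]]].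
have -> : coind_scale (r@_m *: 'X_[m]) (\sum_(g <- u) c g) =
    \sum_(g <- u) coind_scale (r@_m *: 'X_[m]) (c g).
  by apply/funext => s; rewrite /coind_scale !sum_evalE.
apply: rpred_sum => g _; apply: coind_part_mem.
by apply: coind_part_scale (cP g); exact: poly_part_monomial.
Qed.

Record coind_car := CoindCar {
  coind_val :> F;
  coind_valP : coind_val \in coind_mem
}.
HB.instance Definition _ := [isSub for coind_val].
HB.instance Definition _ := [Choice of coind_car by <:].
HB.instance Definition _ := [SubChoice_isSubZmodule of coind_car by <:].

Definition coind_act (r : S) (f : coind_car) : coind_car :=
  CoindCar (coind_scale_mem r (coind_valP f)).

Lemma coind_actA a b f : coind_act a (coind_act b f) = coind_act (a * b) f.
Proof.
by apply: val_inj; apply/funext => s /=; rewrite /coind_scale mulrA.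
Qed.

Lemma coind_act1 : left_id 1 coind_act.
Proof.
by move=> f; apply: val_inj; apply/funext => s /=; rewrite /coind_scale mulr1.
Qed.

Lemma coind_actDr : right_distributive coind_act +%R.
Proof. by move=> a e f; apply: val_inj. Qed.

Lemma coind_actDl f : {morph coind_act^~ f : a b / a + b}.
Proof.
move=> a b; apply: val_inj; apply/funext => s /=; rewrite /coind_scale.
have fP := coind_valP f.
have := coind_mem_sum [:: s * a; s * b] id fP.
by rewrite !big_cons !big_nil !addr0 -mulrDr.
Qed.

HB.instance Definition _ := GRing.Zmodule_isLmodule.Build S coind_car
  coind_actA coind_act1 coind_actDr coind_actDl.

Lemma coind_val_sum (I : Type) (r : seq I) (c : I -> coind_car) :
  coind_val (\sum_(i <- r) c i) = \sum_(i <- r) coind_val (c i).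
Proof. exact: (raddf_sum (val : {additive coind_car -> F})). Qed.

Lemma coind_span (f : coind_car) : exists (s : seq G) (c : G -> coind_car),
  [/\ uniq s, forall g, coind_part g (c g) & f = \sum_(g <- s) c g].
Proof.
have /asboolP[s [c [us cP fE]]] := coind_valP f.
exists s, (fun g => CoindCar (coind_part_mem (cP g))); split=> //.
by apply: val_inj; rewrite /= coind_val_sum.
Qed.

Lemma coind_direct (s : seq G) (c : G -> coind_car) : uniq s ->
  (forall g, coind_part g (c g)) -> \sum_(g <- s) c g = 0 ->
  forall g, g \in s -> c g = 0.
Proof.
move=> us cP /(congr1 coind_val); rewrite coind_val_sum => c0 h hs.
apply: val_inj; apply/funext => t.
rewrite [t]mpolyE /= coind_mem_sum ?coind_valP // big1 // => m _.
apply/funext => g; apply/funext => x.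
set a : S := _ *: _.
have am : poly_part d (mnm_deg d m) a by exact: poly_part_monomial.
have [mh|mh] := eqVneq (mnm_deg d m + h) g; last by case: (cP h) => _ /(_ _ _ g x am mh).
have := congr1 (fun f : F => f a g x) c0; rewrite !fct_sumE.
rewrite (bigD1_seq h) //= big1 ?addr0 // => k kh.
case: (cP k) => _ /(_ _ _ g x am); apply.
by rewrite -mh (inj_eq (addrI _)).
Qed.

Definition coind : grmod R d :=
  GrMod (gr_car := coind_car) (gr_part := fun g f => coind_part g (coind_val f))
    coind_part0 (fun g e f => @coind_partB g e f)
    (fun k h s f => @coind_part_scale k h s f) coind_span coind_direct.

Section Map.
Context (N : grmod R d) (psi : G -> X -> {additive N -> D}).

Definition coind_fun (b : N) : F := fun s g x => psi g x (gcomp g (s *: b)).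

Lemma coind_funB b c : coind_fun (b - c) = coind_fun b - coind_fun c.
Proof.
apply/funext => s; apply/funext => g; apply/funext => x.
by rewrite /coind_fun scalerBr gcompB raddfB.
Qed.

Lemma coind_fun_part h b : gr_part h b -> coind_part h (coind_fun b).
Proof.
move=> hb; split=> [s t|k s g x ks kh].
  apply/funext => g; apply/funext => x.
  by rewrite /coind_fun scalerBl gcompB raddfB.
by rewrite /coind_fun (gcomp_neq (gr_partZ ks hb) kh) raddf0.
Qed.

Lemma coind_funD b c : coind_fun (b + c) = coind_fun b + coind_fun c.
Proof.
have f0 : coind_fun 0 = 0.
  by rewrite -[X in coind_fun X](subrr 0) coind_funB subrr.
have fN e : coind_fun (- e) = - coind_fun e.
  by rewrite -[X in coind_fun X]sub0r coind_funB f0 sub0r.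
by rewrite -[X in coind_fun (_ + X)]opprK coind_funB fN opprK.
Qed.

Lemma coind_fun_mem b : coind_fun b \in coind_mem.
Proof.
have f0 : coind_fun 0 = 0.
  by rewrite -[X in coind_fun X](subrr 0) coind_funB subrr.
have [s [c [_ cP ->]]] := gr_span b; rewrite (big_morph _ coind_funD f0).
by apply: rpred_sum => g _; apply: coind_part_mem; exact: coind_fun_part.
Qed.

Definition coind_lift (b : N) : coind := CoindCar (coind_fun_mem b).

Lemma coind_lift_linear : linear coind_lift.
Proof.
move=> a b c; apply: val_inj; rewrite /= coind_funD; congr (_ + _).
apply/funext => s; apply/funext => g; apply/funext => x.
by rewrite /= /coind_scale /coind_fun scalerA.
Qed.

HB.instance Definition _ := GRing.isLinear.Build S N coind _ coind_lift
  coind_lift_linear.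

Definition coind_hom : grhom N coind :=
  GrHom (gr_fun := coind_lift) coind_fun_part.

End Map.

Lemma coind_injective :
  (forall (y : D) k, (0 < k)%N -> exists z, z *+ k = y) -> gr_injective coind.
Proof.
move=> divD A B i f i_inj.
pose L g x (a : A) : D := (f a : coind_car) 1 g x.
have LB g x : zmod_morphism (L g x).
  by move=> a b; rewrite /L raddfB.
have ext g x : exists psi : {additive B -> D}, forall a, psi (i a) = L g x a.
  pose T : set (B * D) := [set u | exists2 a, u.1 = i a & u.2 = L g x a].
  have gT : addgraph T.
    split.
    - by exists 0; rewrite ?raddf0 // /L raddf0.
    - move=> b c y z [a /= -> ->] [a' /= -> ->].
      by exists (a - a'); rewrite /= ?raddfB ?LB.
    - move=> y [a /= a0 ->]; have -> : a = 0 by apply: i_inj; rewrite raddf0.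
      by rewrite /L raddf0.
  by have [psi psiP] := addgraph_total divD gT; exists psi => a; apply: psiP; exists a.
pose psi g x := projT1 (cid (ext g x)).
have psiP g x a : psi g x (i a) = L g x a by rewrite /psi; case: cid.
exists (coind_hom psi) => a; apply: val_inj; apply/funext => s.
apply/funext => g; apply/funext => x /=.
rewrite /coind_fun -linearZ -grhom_gcomp psiP.
pose Lfun := GRing.isZmodMorphism.Build A D (L g x) (LB g x).
pose LL : {additive A -> D} := HB.pack (L g x) Lfun.
have -> : L g x (gcomp g (s *: a)) = L g x (s *: a).
  apply: (gcomp_additive (L := LL)) => h b hb hg /=.
  have [_ /(_ 0 1 g x)] := gr_fun_part f hb; apply; first exact: poly_part1.
  by rewrite add0r.
by rewrite /L linearZ /= /coind_scale mul1r.
Qed.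

End Coinduced.
Section Resolution.
Context (R : comNzRingType) (n : nat) (G : zmodType) (d : 'I_n -> G).
Local Notation S := {mpoly R[n]}.

Record gr_submod (N : grmod R d) := GrSubmod {
  gr_sub :> N -> Prop;
  gr_sub0 : gr_sub 0;
  gr_subB : forall x y, gr_sub x -> gr_sub y -> gr_sub (x - y);
  gr_subZ : forall s x, gr_sub x -> gr_sub (s *: x);
  gr_sub_comp : forall g x, gr_sub x -> gr_sub (gcomp g x)
}.

Lemma enough_injectives (N : grmod R d) (K : gr_submod N) :
  exists (E : grmod R d) (f : grhom N E),
    gr_injective E /\ forall x, f x = 0 <-> K x.
Proof.
pose X := {chi : {additive N -> QZ} | forall x, K x -> chi x = 0}.
pose psi (g : G) (chi : X) := projT1 chi.
exists (coind R d QZ X), (coind_hom psi); split.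
  exact: coind_injective QZ_divisible.
move=> x; split=> [fx0|Kx]; last first.
  apply: val_inj; apply/funext => s; apply/funext => g; apply/funext => chi.
  rewrite /= /coind_fun /psi; apply: (projT2 chi).
  by apply: gr_sub_comp; exact: gr_subZ.
have Kg g : K (gcomp g x).
  apply: contrapT => nK.
  have [chi chiK] := QZ_separates (gr_sub0 K) (@gr_subB _ K) nK.
  move/eqP; apply.
  have := congr1 (fun e : coind R d QZ X => coind_val e 1 g (exist _ chi chiK)) fx0.
  by rewrite /= /coind_fun /psi /= scale1r.
have [s _ [_ ->]] := gcomp_sum x; elim: s => [|g s IH].
  by rewrite big_nil; exact: gr_sub0.
rewrite big_cons -[X in _ + X]opprK; apply: gr_subB => //.
by rewrite -sub0r; apply: gr_subB => //; exact: gr_sub0.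
Qed.

Lemma gr_image_comp (M N : grmod R d) (f : grhom M N) g :
  forall x, range f x -> range f (gcomp g x).
Proof. by move=> _ [y _ <-]; exists (gcomp g y); rewrite ?grhom_gcomp. Qed.

Definition gr_image (M N : grmod R d) (f : grhom M N) : gr_submod N.
Proof.
apply: (@GrSubmod N (range f)).
- by exists 0; rewrite ?raddf0.
- by move=> _ _ [x _ <-] [y _ <-]; exists (x - y); rewrite ?raddfB.
- by move=> s _ [x _ <-]; exists (s *: x); rewrite ?linearZ.
- exact: gr_image_comp.
Defined.

Definition gr_zero (M : grmod R d) : gr_submod M.
Proof.
apply: (@GrSubmod M [set 0]) => [//|_ _ -> -> /=|s _ -> /=|g _ -> /=].
- by rewrite subr0.
- by rewrite scaler0.
- by rewrite gcomp_id //; exact: gr_part0.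
Defined.

(* A graded module with a graded submodule, to be used for the kernel of the
   next map of a resolution. *)
Let stage := {N : grmod R d & gr_submod N}.

Let env (T : stage) : grmod R d := projT1 (cid (enough_injectives (projT2 T))).
Let env_exists (T : stage) := projT2 (cid (enough_injectives (projT2 T))).
Let env_map (T : stage) : grhom (projT1 T) (env T) :=
  projT1 (cid (env_exists T)).
Let env_inj (T : stage) : gr_injective (env T) :=
  (projT2 (cid (env_exists T))).1.
Let env_ker (T : stage) x : env_map T x = 0 <-> projT2 T x :=
  (projT2 (cid (env_exists T))).2 x.

Let next (T : stage) : stage := existT _ (env T) (gr_image (env_map T)).

Lemma injres_exists (M : grmod R d) : exists _ : inj_resolution M, True.
Proof.
pose st k : stage := iter k next (existT _ M (gr_zero M)).
apply: (fun r => ex_intro _ r I).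
apply: (@InjResolution _ _ _ _ M (fun k => env (st k)) (env_map (st 0))
                       (fun k => env_map (st k.+1))).
- by move=> k; exact: env_inj.
- apply: raddf_inj => x /env_ker; exact.
- move=> x; split=> [/env_ker[y _ <-]|[y ->]]; first by exists y.
  by apply/env_ker; exists y.
- move=> k x; split=> [/env_ker[y _ <-]|[y ->]]; first by exists y.
  by apply/env_ker; exists y.
Qed.

Definition injres (M : grmod R d) : inj_resolution M :=
  projT1 (cid (injres_exists M)).

End Resolution.
Section LocalCohomology.
Context (R : comNzRingType) (n : nat) (G : zmodType) (d : 'I_n -> G).
Local Notation S := {mpoly R[n]}.
Implicit Types (A : set S) (M : grmod R d) (g : G).

Definition torsion A M : set M :=
  [set x | exists k, forall a, ideal_exp A k a -> a *: x = 0].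

Lemma ideal_exp_leq A k l : (k <= l)%N -> ideal_exp A l `<=` ideal_exp A k.
Proof.
move=> kl; apply: smallest_sub; first exact: ideal_gen_ideal.
move=> _ [s [sl sA] <-] I [[_ _ IZ] sI].
rewrite -(cat_take_drop k s) big_cat /= mulrC.
apply: (IZ); apply: sI; exists (take k s) => //; split.
  by rewrite size_takel // sl.
by move=> a /mem_take; exact: sA.
Qed.

Lemma torsionB A M (x y : M) :
  torsion A x -> torsion A y -> torsion A (x - y).
Proof.
move=> [k kx] [l ly]; exists (maxn k l) => a Aa.
rewrite scalerBr kx ?ly ?subr0 //.
  exact: ideal_exp_leq (leq_maxr k l) _ Aa.
exact: ideal_exp_leq (leq_maxl k l) _ Aa.
Qed.

Lemma torsion0 A M : torsion A (0 : M).
Proof. by exists 0 => a _; rewrite scaler0. Qed.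

Section Complex.
Context (A : set S) (M : grmod R d) (E : inj_resolution M) (g : G).

(* Cocycles and coboundaries of the degree-g strand of the complex of
   A-torsion submodules of the resolution E. *)
Definition cocycle (i : nat) : set (ir_mod E i) :=
  [set x | [/\ torsion A x, gr_part g x & ir_diff E i x = 0]].

Definition coboundary (i : nat) : set (ir_mod E i) :=
  match i return set (ir_mod E i) with
  | 0 => [set 0]
  | j.+1 => [set ir_diff E j y | y in [set y | torsion A y /\ gr_part g y]]
  end.

Definition coboundary_pred (i : nat) : {pred ir_mod E i} :=
  fun x => `[< coboundary x >].

Lemma coboundary_zmod_closed i : zmod_closed (@coboundary_pred i).
Proof.
case: i => [|j]; split=> [|x y].
- exact/asboolP.
- by move=> /asboolP -> /asboolP ->; apply/asboolP; rewrite subr0.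
- apply/asboolP; exists 0; rewrite ?raddf0 //.
  by split; [exact: torsion0 | exact: gr_part0].
- move=> /asboolP[a [Aa ga] <-] /asboolP[b [Ab gb] <-]; apply/asboolP.
  exists (a - b); rewrite ?raddfB //.
  by split; [exact: torsionB | exact: gr_partB].
Qed.
HB.instance Definition _ i := GRing.isZmodClosed.Build (ir_mod E i)
  (@coboundary_pred i) (@coboundary_zmod_closed i).

End Complex.

(* H^i_A(M)_g, as a set of classes modulo coboundaries: the right derived
   functors of the A-torsion functor on graded modules. *)
Definition local_cohomology A i M g :
    set (Quotient.quot (@coboundary_pred A M (injres M) g i)) :=
  [set \pi x | x in @cocycle A M (injres M) g i].

Definition lc_vanishing A i M : set G :=
  [set g | @local_cohomology A i M g = [set 0]].

End LocalCohomology.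

(* Main.v *)
(* Only the pairwise case uses injectivity.  If x of degree g in an injective E
   is torsion for the intersection of two monomial ideals P and Q, then, after
   replacing P and Q by ideals of high powers, the map P + Q -> E that is 0 on P
   and f |-> f x on Q is well defined; it extends to S, and the image y of 1
   splits x = y + (x - y) into a P-torsion and a Q-torsion part.  Hence
   0 -> T_(P+Q) E -> T_P E (+) T_Q E -> T_(P :&: Q) E -> 0 is exact, where T_P
   is P-torsion, and H^i_P, H^i_Q, H^(i+1)_(P+Q) vanishing in degree g makes
   H^i_(P :&: Q) vanish there.  Torsion depends only on the radical of the
   ideal, and radical monomial ideals form a distributive lattice, so the
   identity B_1 + \bigcap_j B_j = \bigcap_j (B_1 + B_j) drives an induction on
   the number of ideals. *)
From HB Require Import structures.
Require Import Defs.
From mathcomp Require Import all_boot all_order all_algebra.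
From mathcomp Require Import boolp classical_sets functions.
From mathcomp Require Import mpoly.

Set Implicit Arguments.
Unset Strict Implicit.
Unset Printing Implicit Defensive.

Import GRing.Theory.

Local Open Scope classical_set_scope.
Local Open Scope ring_scope.

(** * Radicals of ideals as intersections of primes *)

Section Radical.
Context (A : comNzRingType).
Implicit Types (I J : set A) (a b f : A).

Definition colon_ideal J a : set A := [set r | J (a * r)].

Lemma colon_ideal_ideal J a : is_ideal J -> is_ideal (colon_ideal J a).
Proof.
case=> J0 JD JZ; split=> [|r s Jr Js|r s Js]; rewrite /colon_ideal /=.
- by rewrite mulr0.
- by rewrite mulrDr; exact: JD.
- by rewrite mulrCA; exact: JZ.
Qed.

(* Induction on N: expanding the first factor over the generators leads, for each
   generator a, to the ideal (J : a), which contains a ^ (k a - 1). *)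
Lemma ideal_gen_seq_prod (s : seq A) (N : nat) J (k : A -> nat) :
  is_ideal J -> (forall a, a \in s -> J (a ^+ k a)) ->
  (\sum_(a <- s) k a <= N)%N ->
  forall u : seq A, (N < size u)%N ->
    (forall b, b \in u -> ideal_gen [set` s] b) -> J (\prod_(b <- u) b).
Proof.
elim: N J k => [|N IH] J k idJ Jk; have [J0 JD JZ] := idJ.
all: move=> kN [|b u] // uN us; rewrite big_cons.
all: suff sJ : ideal_gen [set` s] `<=` [set c | J (c * \prod_(b <- u) b)]
  by apply: sJ; apply: us; rewrite mem_head.
all: apply: smallest_sub => [|a as_];
  [by split=> [|c e Jc Je|r c Jc] /=;
    [rewrite mul0r|rewrite mulrDl; exact: JD|rewrite -mulrA; exact: JZ]|].
(* If [k a = 0], then [J] contains [a ^+ 0 = 1], hence everything. For [N = 0] no other case can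
   occur, since the exponents sum to 0. *)
all: have [ka|ka] := posnP (k a);
  [by rewrite /= -[_ * _]mulr1 -[1](expr0 a) -ka; apply/JZ/Jk|].
  by move: kN; rewrite (big_rem a) //= leqn0 addn_eq0 -leqn0 leqNgt ka.
pose k' c := if c == a then (k a).-1 else k c.
apply: (IH (colon_ideal J a) k') => //.
- exact: colon_ideal_ideal.
- move=> c cs; rewrite /colon_ideal /= /k'; case: eqP => [->|_].
    by rewrite -exprS prednK //; exact: Jk.
  by apply: JZ; exact: Jk.
- rewrite -ltnS; apply: leq_trans kN.
  rewrite (big_rem a) //= [X in (_ < X)%N](big_rem a) //=.
  rewrite /k' eqxx -addSn prednK // leq_add2l.
  by apply: leq_sum => c _; case: eqP => [->|//]; exact: leq_pred.
- by move=> c cu; apply: us; rewrite inE cu orbT.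
Qed.

Definition ideal_adjoin J a : set A := [set u | exists q r, J q /\ u = q + r * a].

Lemma ideal_adjoinP J a : is_ideal J -> is_ideal (ideal_adjoin J a).
Proof.
case=> J0 JD JZ; split=> [|_ _ [q [r [Jq ->]]] [q' [r' [Jq' ->]]]|s _ [q [r [Jq ->]]]].
- by exists 0, 0; rewrite mul0r addr0.
- by exists (q + q'), (r + r'); rewrite mulrDl addrACA; split=> //; exact: JD.
- by exists (s * q), (s * r); rewrite mulrDr mulrA; split=> //; exact: JZ.
Qed.

(** An ideal [Q] maximal among those containing [I] and avoiding the powers of [f] is prime: if [a]
    and [b] lie outside [Q], then [Q + (a)] and [Q + (b)] contain powers of [f], and the product of
    these powers would lie in [Q] if [a * b] did. *)
Lemma prime_avoiding I f : is_ideal I -> (forall k, ~ I (f ^+ k)) ->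
  exists2 P, vanishing I P & ~ P f.
Proof.
move=> idI If.
(* set0 is allowed because Zorn_bigcup also needs the union of the empty chain. *)
pose avoid J := J = set0 \/ [/\ is_ideal J, I `<=` J & forall k, ~ J (f ^+ k)].
have avI : avoid I by right; split.
have [|Q [[Q0|[idQ IQ Qf]] Qmax]] := @Zorn_bigcup _ avoid.
- move=> F Fav Ftot.
  have [[V FV [v Vv]]|F0] := pselect (exists2 V, F V & V !=set0); last first.
    left; apply/seteqP; split=> // u [V FV Vu].
    by case: F0; exists V => //; exists u.
  have Fne W w : F W -> W w ->
      [/\ is_ideal W, I `<=` W & forall k, ~ W (f ^+ k)].
    by move=> FW Ww; case: (Fav _ FW) => // W0; rewrite W0 in Ww.
  right; split; last by move=> k [W FW Wk]; have [_ _ /(_ k)] := Fne _ _ FW Wk.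
    split.
    + by exists V => //; case: (Fne _ _ FV Vv) => -[].
    + move=> a b [V1 F1 V1a] [V2 F2 V2b].
      have [V3 [F3 V3a V3b]] : exists V3, [/\ F V3, V3 a & V3 b].
        by case: (Ftot _ _ F1 F2) => s; [exists V2|exists V1]; split=> //; apply: s.
      by exists V3 => //; case: (Fne _ _ F3 V3a) => -[_ VD _] _ _; exact: VD.
    + move=> r a [V1 F1 V1a]; exists V1 => //.
      by case: (Fne _ _ F1 V1a) => -[_ _ VZ] _ _; exact: VZ.
  by move=> x Ix; exists V => //; case: (Fne _ _ FV Vv) => _ IV _; exact: IV.
(* The maximal element is not [set0], since [I] is a strictly larger candidate. *)
- exfalso; apply: (Qmax I) => //; rewrite Q0; split=> // sI.
  by case: idI => I0 _ _; exact: sI I0.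
have [Q0 QD QZ] := idQ.
have adj a : ~ Q a -> exists k, ideal_adjoin Q a (f ^+ k).
  move=> nQa; apply: contrapT => nf; apply: (Qmax (ideal_adjoin Q a)).
    split=> [q Qq|sub]; first by exists q, 0; rewrite mul0r addr0.
    by apply/nQa/sub; exists 0, 1; rewrite mul1r add0r.
  right; split=> [||k fk]; [exact: ideal_adjoinP| |by apply: nf; exists k].
  by move=> q /IQ Qq; exists q, 0; rewrite mul0r addr0.
exists Q; last by move=> Q1; apply: (Qf 1); rewrite expr1.
split=> //; split=> // [Q1|a b Qab]; first by apply: (Qf 0); rewrite expr0.
apply: contrapT => /not_orP[/adj[k [q [r [Qq fk]]]] /adj[l [q' [r' [Qq' fl]]]]].
apply: (Qf (k + l)); rewrite exprD fk fl mulrDl; apply: (QD).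
  by rewrite mulrC; exact: QZ.
by rewrite mulrDr; apply: (QD); [|rewrite mulrACA]; exact: QZ.
Qed.

(** Primes are closed under roots, and [prime_avoiding] gives the converse. This turns equations
    between closed sets into equations between radicals. *)
Lemma radical_vanishing I f : is_ideal I ->
  (exists k, I (f ^+ k)) <-> forall P, vanishing I P -> P f.
Proof.
move=> idI; split=> [[k Ik] P [[[P0 _ _] P1 PM] IP]|Pf].
  have {Ik} := IP _ Ik; elim: k => [|k IH]; first by rewrite expr0.
  by rewrite exprS => /PM[].
apply: contrapT => nk; have [|P VP] := @prime_avoiding I f idI; last by apply; exact: Pf.
by move=> k Ik; apply: nk; exists k.
Qed.

End Radical.

(** * Monomial ideals and the supports of their radicals *)

Section MonomialIdeals.
Context (n : nat).
Implicit Types (m p : 'X_{1..n}) (X : set 'X_{1..n}) (sigma tau : {set 'I_n}).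

(* Induction on the number of coordinates compared: beyond the largest k-th
   coordinate N of the elements found so far only the N slices below it remain. *)
Lemma dickson X : exists2 s : seq 'X_{1..n}, (forall m, m \in s -> X m) &
  forall m, X m -> exists2 p, p \in s & (p <= m)%MM.
Proof.
suff dck k : forall X, exists2 s : seq 'X_{1..n}, (forall m, m \in s -> X m) &
    forall m, X m -> exists2 p, p \in s & forall i : 'I_n, (i < k)%N -> (p i <= m i)%N.
  have [s sX Xs] := dck n X; exists s => // m /Xs[p ps pm]; exists p => //.
  by apply/mnm_lepP => i; exact: pm.
elim: k => {X} [X|k IH X].
  have [[m Xm]|X0] := pselect (exists m, X m); last first.
    by exists [::] => // m Xm; case: X0; exists m.
  by exists [:: m] => [p /[!inE]/eqP->//|p _]; exists m; rewrite ?mem_head.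
have [nk|kn] := leqP n k.
  have [s sX Xs] := IH X; exists s => // m /Xs[p ps pm]; exists p => // i _.
  by apply: pm; exact: leq_trans nk.
pose ik := Ordinal kn.
have [s sX Xs] := IH X.
have exc : forall v : nat, exists s : seq 'X_{1..n}, (forall m, m \in s -> X m) /\
    forall m, X m -> m ik = v ->
    exists2 p : 'X_{1..n}, p \in s & forall i : 'I_n, (i < k.+1)%N -> (p i <= m i)%N.
  move=> v; have [u uX Xu] := IH (X `&` [set m : 'X_{1..n} | m ik = v]).
  exists u; split=> [m /uX[]//|m Xm mv]; have [p pu pm] := Xu m (conj Xm mv).
  exists p => // i; rewrite ltnS leq_eqVlt => /orP[/eqP ik'|/pm//].
  have -> : i = ik by exact: val_inj.
  by have [_ ->] := uX _ pu; rewrite mv.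
have [c cP] := choice exc; pose N := \max_(p <- s) p ik.
exists (s ++ flatten [seq c v | v <- iota 0 N]) => [m|m Xm].
  by rewrite mem_cat => /orP[/sX//|/flatten_mapP[v _ /(cP v).1]].
have [Nm|mN] := leqP N (m ik); last first.
  have [p pc pm] := (cP (m ik)).2 m Xm erefl; exists p => //.
  rewrite mem_cat; apply/orP; right; apply/flatten_mapP; exists (m ik) => //.
  by rewrite mem_iota.
have [p ps pm] := Xs m Xm; exists p => [|i]; first by rewrite mem_cat ps.
rewrite ltnS leq_eqVlt => /orP[/eqP ik'|/pm//].
have -> : i = ik by exact: val_inj.
by apply: leq_trans Nm; rewrite /N (big_rem p) //= leq_maxl.
Qed.

Definition sqfree_mnm sigma : 'X_{1..n} := [multinom (i \in sigma : nat) | i < n].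

Context (R : comNzRingType).
Local Notation S := {mpoly R[n]}.
Implicit Types (A : set S).

Lemma mpolyX_le m p : (m <= p)%MM -> 'X_[p] = 'X_[(p - m)%MM] * 'X_[m] :> S.
Proof. by move=> mp; rewrite -mpolyXD submK. Qed.

(** The working form of a monomial ideal: no generating set is chosen, so the condition passes
    easily to sums. *)
Definition mnm_ideal A : Prop :=
  is_ideal A /\ forall a m, A a -> m \in msupp a -> A 'X_[m].

Lemma ideal_mpolyX_le A m p : is_ideal A -> A 'X_[m] -> (m <= p)%MM -> A 'X_[p].
Proof. by case=> _ _ AZ Am /mpolyX_le ->; exact: AZ. Qed.

Lemma ideal_big A (T : eqType) (s : seq T) (F : T -> S) :
  is_ideal A -> (forall x, x \in s -> A (F x)) -> A (\sum_(x <- s) F x).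
Proof.
case=> A0 AD _ AF; rewrite big_seq.
by apply: (big_ind A) => // x; exact: AF.
Qed.

(** The polynomials all of whose monomials lie in the ideal form an ideal that contains the
    generators. *)
Lemma is_monomial_ideal_mnm A : is_monomial_ideal A -> mnm_ideal A.
Proof.
case=> X ->; split; first exact: ideal_gen_ideal.
set J := ideal_gen _; have idJ : is_ideal J by exact: ideal_gen_ideal.
pose K : set S := [set a | forall m, m \in msupp a -> J 'X_[m]].
suff : J `<=` K by move=> JK a m /JK; exact.
apply: smallest_sub => [|_ [m Xm <-] p]; last first.
  by rewrite msuppX inE => /eqP ->; apply: sub_gen_smallest; exists m.
split=> [m|a b Ka Kb m|r a Ka m]; first by rewrite mcoeff_msupp mcoeff0 eqxx.
  by move=> /msuppD_le; rewrite mem_cat => /orP[/Ka|/Kb].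
move=> /msuppM_le /allpairsP[[p q] [/= _ qa ->]].
by rewrite mpolyXD; case: idJ => _ _; apply; exact: Ka.
Qed.

(** Dickson's lemma applied to the exponents of monomials in [A]: each term of an element of [A] is
    a multiple of a listed monomial. *)
Lemma mnm_ideal_fg A : mnm_ideal A -> exists2 s : seq 'X_{1..n},
  (forall m, m \in s -> A 'X_[m]) & A `<=` ideal_gen [set` [seq 'X_[m] : S | m <- s]].
Proof.
case=> idA Am; have [s sA As] := dickson [set m | A 'X_[m]].
have idJ := @ideal_gen_ideal S [set` [seq 'X_[m] : S | m <- s]].
exists s => // a Aa; rewrite [a]mpolyE; apply: ideal_big => // m ma.
rewrite -mul_mpolyC; case: (idJ) => _ _; apply.
have /As[p ps pm] := Am a m Aa ma.
by apply: ideal_mpolyX_le pm => //; apply: sub_gen_smallest; apply/mapP; exists p.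
Qed.

(* Encodes the radical of a monomial ideal A by the supports of its monomials;
   sums and intersections of ideals become unions and intersections. *)
Definition rad_supp A : {set {set 'I_n}} :=
  [set sigma | `[< exists k, A ('X_[sqfree_mnm sigma] ^+ k) >]]%SET.

Lemma rad_suppP A sigma :
  reflect (exists k, A ('X_[sqfree_mnm sigma] ^+ k)) (sigma \in rad_supp A).
Proof. by rewrite inE; exact: asboolP. Qed.

Definition supp_up (U : {set {set 'I_n}}) : Prop :=
  forall sigma tau, sigma \subset tau -> sigma \in U -> tau \in U.

Lemma sqfree_mnm_le sigma m : (forall i, i \in sigma -> (0 < m i)%N) ->
  (sqfree_mnm sigma <= m)%MM.
Proof.
move=> sm; apply/mnm_lepP => i; rewrite mnmE.
by case: (boolP (i \in sigma)) => // /sm.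
Qed.

Lemma rad_supp_up A : is_ideal A -> supp_up (rad_supp A).
Proof.
move=> idA sigma tau st /rad_suppP[k Ak]; apply/rad_suppP; exists k.
rewrite (@mpolyX_le (sqfree_mnm sigma) (sqfree_mnm tau)); last first.
  by apply: sqfree_mnm_le => i si; rewrite mnmE (fintype.subsetP st _ si).
by rewrite exprMn; case: idA => _ _; apply.
Qed.

(** By [radical_vanishing], the radical of [A] is the intersection of the radicals of the [C j];
    here this is read on squarefree monomials. *)
Lemma rad_supp_vanishing A (T : finType) (C : T -> set S) :
  is_ideal A -> (forall j, is_ideal (C j)) ->
  vanishing A = \bigcup_(j : T) vanishing (C j) ->
  rad_supp A = (\bigcap_(j in [set: T]) rad_supp (C j))%SET.
Proof.
move=> idA idC VA; apply/setP => sigma; apply/rad_suppP/bigcapP => [|Cs].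
  move/(radical_vanishing _ idA) => Pf j _; apply/rad_suppP.
  by apply/(radical_vanishing _ (idC j)) => P VP; apply: Pf; rewrite VA; exists j.
apply/(radical_vanishing _ idA) => P; rewrite VA => -[j _]; move: P.
by apply/(radical_vanishing _ (idC j))/rad_suppP; apply: Cs; rewrite inE.
Qed.

Section Sum.
Context (t : nat) (B : 'I_t -> set S) (J : {set 'I_t}).
Hypothesis BM : forall j, mnm_ideal (B j).

Lemma mnm_ideal_sum_mem a m : ideal_sum B J a -> m \in msupp a ->
  exists2 j, j \in J & B j 'X_[m].
Proof.
move=> [b Bb <-] /msupp_sum_le /flatten_mapP[j].
rewrite mem_filter => /andP[jJ _] mb; exists j => //.
by apply: (BM j).2 mb; exact: Bb.
Qed.

Lemma ideal_sum_mem j a : j \in J -> B j a -> ideal_sum B J a.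
Proof.
move=> jJ Ba; exists (fun l => if l == j then a else 0) => [l _|]; last first.
  by rewrite (bigD1 j) //= eqxx big1 ?addr0 // => l /andP[_ /negPf ->].
by case: eqP => [->//|_]; case: (BM l) => -[].
Qed.

Lemma mnm_ideal_sum : mnm_ideal (ideal_sum B J).
Proof.
split; last by move=> a m Ba /(mnm_ideal_sum_mem Ba)[j]; exact: ideal_sum_mem.
split.
- by exists (fun _ => 0) => [j _|]; [case: (BM j) => -[]|rewrite big1].
- move=> _ _ [b Bb <-] [c Bc <-]; rewrite -big_split.
  exists (fun j => b j + c j) => // j jJ.
  by case: (BM j) => -[_ BD _] _; apply: (BD); [exact: Bb|exact: Bc].
- move=> r _ [b Bb <-]; rewrite mulr_sumr; exists (fun j => r * b j) => // j jJ.
  by case: (BM j) => -[_ _ BZ] _; apply: (BZ); exact: Bb.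
Qed.

(** A power of a monomial is a monomial, and a monomial in a sum of monomial ideals already lies in
    one of them. *)
Lemma rad_supp_sum :
  rad_supp (ideal_sum B J) = (\bigcup_(j in J) rad_supp (B j))%SET.
Proof.
apply/setP => sigma; apply/rad_suppP/bigcupP => [[k]|[j jJ /rad_suppP[k Bk]]].
  rewrite mpolyXn => Bk.
  have [|j jJ Bj] := mnm_ideal_sum_mem (m := (sqfree_mnm sigma *+ k)%MM) Bk.
    by rewrite msuppX mem_head.
  by exists j => //; apply/rad_suppP; exists k; rewrite mpolyXn.
by exists k; exact: ideal_sum_mem jJ Bk.
Qed.

End Sum.
End MonomialIdeals.

(** * Torsion in terms of squarefree monomials *)

Section Torsion.
Context (R : comNzRingType) (n : nat) (G : zmodType) (d : 'I_n -> G).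
Local Notation S := {mpoly R[n]}.

(** Torsion for the ideal generated by the squarefree monomials with support in [U]; the exponent
    may vary with the monomial. *)
Definition supp_torsion (U : {set {set 'I_n}}) (M : grmod R d) : set M :=
  [set x | forall sigma, sigma \in U ->
    exists k, ('X_[sqfree_mnm sigma] : S) ^+ k *: x = 0].

Lemma annihilator_ideal (M : lmodType S) (x : M) : is_ideal [set a : S | a *: x = 0].
Proof.
split=> [|a b ax bx|r a ax] /=; first exact: scale0r.
  by rewrite scalerDl ax bx addr0.
by rewrite -scalerA ax scaler0.
Qed.

(** For the harder inclusion, some power of each of finitely many monomial generators kills [x], so
    by [ideal_gen_seq_prod] every long enough product of elements of [A] does. The equation is
    between functions of [M], to be rewritten in all terms of a resolution at once. *)
Lemma torsion_rad_supp (A : set S) : mnm_ideal A ->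
  (fun M : grmod R d => @torsion _ _ _ _ A M) = supp_torsion (rad_supp A).
Proof.
move=> mA; have [idA _] := mA; apply/functional_extensionality_dep => M.
apply/seteqP; split=> x.
  move=> [k xk] sigma /rad_suppP[e Ae]; exists (e * k)%N; rewrite exprM.
  apply: xk; apply: sub_gen_smallest; exists (nseq k ('X_[sqfree_mnm sigma] ^+ e)).
    by split; [exact: size_nseq|move=> a /nseqP[->]].
  by rewrite big_nseq -Monoid.iteropE.
move=> xt; have [s sA As] := mnm_ideal_fg mA.
pose Ann : set S := [set a | a *: x = 0].
have exk : forall a : S, exists k, a \in [seq 'X_[m] : S | m <- s] -> Ann (a ^+ k).
  move=> a; have [/mapP[m ms ->]|] := boolP (a \in _); last by exists 0.
  (* The support of [m]: a power of its squarefree monomial is a multiple of ['X_[m]], so [xt]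
     applies, and ['X_[m]] is a multiple of that squarefree monomial, so the exponent carries
     over. *)
  pose sigma : {set 'I_n} := finset (fun i => 0 < m i)%N.
  have [|k xk] := xt sigma.
    apply/rad_suppP; exists (\max_i m i); rewrite mpolyXn.
    apply: ideal_mpolyX_le (sA _ ms) _ => //; apply/mnm_lepP => i.
    rewrite mulmnE mnmE inE; case: posnP => [->//|_]; rewrite mul1n.
    exact: (leq_bigmax i).
  exists k => _; rewrite (@mpolyX_le _ _ (sqfree_mnm sigma) m).
    by rewrite exprMn /Ann /= -scalerA xk scaler0.
  by apply: sqfree_mnm_le => i; rewrite inE.
have [k kP] := choice exk.
exists (\sum_(a <- [seq 'X_[m] : S | m <- s]) k a).+1.
apply: smallest_sub => [|_ [u [su uA] <-]]; first exact: annihilator_ideal.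
apply: (ideal_gen_seq_prod _ kP (leqnn _)); [exact: annihilator_ideal|by rewrite su|].
by move=> b /uA /As.
Qed.

End Torsion.

(** * Splitting elements of graded injectives along two monomial ideals *)

Record upset (n : nat) := UpSet {
  in_upset :> pred 'X_{1..n};
  upsetD : forall p m, in_upset m -> in_upset (p + m)%MM
}.

Definition upset_full (n : nat) : upset n := UpSet (fun p m (_ : predT m) => isT).

Section Split.
Context (R : comNzRingType) (n : nat) (G : zmodType) (d : 'I_n -> G).
Local Notation S := {mpoly R[n]}.
Implicit Types (m p : 'X_{1..n}) (P Q : upset n).

(** The monomial ideal with exponent set [P]. *)
Definition supported_in P : {pred S} := fun f => all P (msupp f).

Lemma supported_inP P f : reflect (forall m, m \in msupp f -> P m) (f \in supported_in P).
Proof. exact: allP. Qed.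

Lemma supported_in_zmod_closed P : zmod_closed (supported_in P).
Proof.
split=> [|f h /supported_inP fP /supported_inP hP]; apply/supported_inP => m.
  by rewrite mcoeff_msupp mcoeff0 eqxx.
by move=> /msuppB_le; rewrite mem_cat => /orP[/fP|/hP].
Qed.
HB.instance Definition _ P :=
  GRing.isZmodClosed.Build S (supported_in P) (supported_in_zmod_closed P).

Lemma supported_inM P (r f : S) : f \in supported_in P -> r * f \in supported_in P.
Proof.
move=> /supported_inP fP; apply/supported_inP => m.
by move=> /msuppM_le/allpairsP[[p q] [/= _ /fP Pq ->]]; exact: upsetD.
Qed.

Definition mpoly_filter (D : pred 'X_{1..n}) (f : S) : S :=
  \sum_(m <- msupp f | D m) f@_m *: 'X_[m].

Lemma mcoeff_filter D f m : (mpoly_filter D f)@_m = if D m then f@_m else 0.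
Proof.
rewrite raddf_sum /=; case: ifP => Dm; last first.
  rewrite big1 // => p Dp; rewrite mcoeffZ mcoeffX.
  case: eqP => [pm|_]; last by rewrite mulr0.
  by rewrite -pm Dp in Dm.
have term p : p != m -> (if D p then (f@_p *: 'X_[p])@_m else 0) = 0.
  by move=> /negPf pm; rewrite mcoeffZ mcoeffX pm mulr0 if_same.
rewrite big_mkcond /=; have [mf|mf] := boolP (m \in msupp f).
  rewrite (bigD1_seq m) //= Dm mcoeffZ mcoeffX eqxx mulr1 big1 ?addr0 //.
rewrite big_seq big1 => [|p pf]; first by apply/esym/eqP; rewrite mcoeff_eq0.
by apply: term; apply: contraNneq mf => <-.
Qed.

Lemma msupp_filter D f m : m \in msupp (mpoly_filter D f) -> D m /\ m \in msupp f.
Proof. by rewrite !mcoeff_msupp mcoeff_filter; case: ifP; rewrite ?eqxx. Qed.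

Record supp_car P := SuppCar {
  supp_val :> S;
  supp_valP : supp_val \in supported_in P
}.
HB.instance Definition _ P := [isSub for @supp_val P].
HB.instance Definition _ P := [Choice of supp_car P by <:].
HB.instance Definition _ P := [SubChoice_isSubZmodule of supp_car P by <:].

Definition supp_act P (r : S) (f : supp_car P) : supp_car P :=
  SuppCar (supported_inM r (supp_valP f)).

Section Module.
Context (P : upset n).

Lemma supp_actA a b (f : supp_car P) : supp_act a (supp_act b f) = supp_act (a * b) f.
Proof. by apply: val_inj; rewrite /= mulrA. Qed.

Lemma supp_act1 : left_id 1 (@supp_act P).
Proof. by move=> f; apply: val_inj; rewrite /= mul1r. Qed.

Lemma supp_actDr : right_distributive (@supp_act P) +%R.
Proof. by move=> a e f; apply: val_inj; rewrite /= mulrDr. Qed.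

Lemma supp_actDl f : {morph (@supp_act P)^~ f : a b / a + b}.
Proof. by move=> a b; apply: val_inj; rewrite /= mulrDl. Qed.

HB.instance Definition _ := GRing.Zmodule_isLmodule.Build S (supp_car P)
  supp_actA supp_act1 supp_actDr supp_actDl.

Lemma supp_val_sum (I : Type) (r : seq I) (c : I -> supp_car P) :
  supp_val (\sum_(i <- r) c i) = \sum_(i <- r) supp_val (c i).
Proof. exact: (raddf_sum (val : {additive supp_car P -> S})). Qed.

Context (g : G).

(** The shift by [g] puts 1 in degree [g], so that multiplication by an element [x] of degree [g]
    becomes a map of degree 0. *)
Definition supp_part (h : G) : set (supp_car P) :=
  [set f | poly_part d (h - g) (f : S)].

Lemma supp_part0 h : supp_part h 0.
Proof. by move=> m; rewrite mcoeff_msupp mcoeff0 eqxx. Qed.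

Lemma supp_partB h e f : supp_part h e -> supp_part h f -> supp_part h (e - f).
Proof. by move=> eh fh m /msuppB_le; rewrite mem_cat => /orP[/eh|/fh]. Qed.

Lemma supp_partZ k h s f : poly_part d k s -> supp_part h f -> supp_part (k + h) (s *: f).
Proof. by move=> ks hf; rewrite /supp_part /= -addrA; exact: poly_partM. Qed.

Lemma supp_filter D (f : supp_car P) : mpoly_filter D f \in supported_in P.
Proof.
apply/supported_inP => m /msupp_filter[_]; have /supported_inP := supp_valP f; exact.
Qed.

Lemma supp_span (f : supp_car P) : exists (s : seq G) (c : G -> supp_car P),
  [/\ uniq s, forall h, supp_part h (c h) & f = \sum_(h <- s) c h].
Proof.
exists (undup [seq mnm_deg d m + g | m <- msupp f]).
exists (fun h => SuppCar (supp_filter (fun m => mnm_deg d m + g == h) f)).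
split=> [|h m /msupp_filter[/eqP<-]|]; [exact: undup_uniq|by rewrite addrK|].
apply: val_inj; rewrite /= supp_val_sum /=; apply/mpolyP => m.
rewrite raddf_sum /=; have [mf|mf] := boolP (m \in msupp f).
  rewrite (bigD1_seq (mnm_deg d m + g)) ?undup_uniq //=; last first.
    by rewrite mem_undup; apply/mapP; exists m.
  rewrite mcoeff_filter eqxx big1 ?addr0 // => h /negPf hm.
  by rewrite mcoeff_filter eq_sym hm.
have f0 : (f : S)@_m = 0 by move: mf; rewrite mcoeff_msupp negbK => /eqP.
by rewrite f0 big1 // => h _; rewrite mcoeff_filter f0 if_same.
Qed.

Lemma supp_direct (s : seq G) (c : G -> supp_car P) : uniq s ->
  (forall h, supp_part h (c h)) -> \sum_(h <- s) c h = 0 ->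
  forall h, h \in s -> c h = 0.
Proof.
move=> us cP /(congr1 (@supp_val P)); rewrite supp_val_sum => c0 h hs.
apply: val_inj; apply/mpolyP => m /=; rewrite mcoeff0.
apply/eqP; apply: contraT; rewrite -mcoeff_msupp => mc; have mh := cP h m mc.
have /eqP := congr1 (mcoeff m) c0; rewrite raddf_sum /= (bigD1_seq h) //= big1.
  by rewrite addr0 mcoeff0 mcoeff_eq0 mc.
move=> k kh; apply/eqP; rewrite mcoeff_eq0; apply: contra kh => /cP.
by rewrite mh => /addIr ->.
Qed.

Definition supp_mod : grmod R d :=
  GrMod supp_part0 supp_partB supp_partZ supp_span supp_direct.

End Module.

Section Incl.
Context (P Q : upset n) (g : G) (PQ : forall m, P m -> Q m).

Lemma supported_in_sub f : f \in supported_in P -> f \in supported_in Q.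
Proof. by move=> /supported_inP fP; apply/supported_inP => m /fP; exact: PQ. Qed.

Definition supp_incl (f : supp_mod P g) : supp_mod Q g :=
  SuppCar (supported_in_sub (supp_valP f)).

Lemma supp_incl_linear : linear supp_incl.
Proof. by move=> a b c; apply: val_inj. Qed.
HB.instance Definition _ := GRing.isLinear.Build S (supp_mod P g) (supp_mod Q g) _
  supp_incl supp_incl_linear.

Lemma supp_incl_part h (f : supp_mod P g) : gr_part h f -> gr_part h (supp_incl f).
Proof. by []. Qed.

Definition supp_incl_hom : grhom (supp_mod P g) (supp_mod Q g) :=
  GrHom (gr_fun := supp_incl) supp_incl_part.

Lemma supp_incl_inj : injective supp_incl_hom.
Proof. by move=> f h /(congr1 (@supp_val Q)) fh; apply: val_inj. Qed.

End Incl.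

Lemma upsetUD P Q p m : P m || Q m -> P (p + m)%MM || Q (p + m)%MM.
Proof. by case/orP => /upsetD ->; rewrite ?orbT. Qed.

Definition upsetU P Q : upset n := UpSet (@upsetUD P Q).

Section Proj.
Context (P Q : upset n) (g : G) (E : grmod R d) (x : E).
Hypothesis gx : gr_part g x.
Hypothesis PQx : forall m, P m -> Q m -> ('X_[m] : S) *: x = 0.

(** Zero on monomials in [P], multiplication by [x] on the others, which lie in [Q]. The two
    prescriptions agree on the overlap by [PQx]. *)
Definition supp_proj (f : supp_mod (upsetU P Q) g) : E :=
  mpoly_filter (predC P) (f : S) *: x.

Lemma supp_proj_linear : linear supp_proj.
Proof.
move=> a b c; rewrite /supp_proj scalerA -scalerDl.
apply/eqP; rewrite -subr_eq0 -scalerBl; set f := _ - _.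
(* [f] measures the failure of the filter to be linear. It lies in [Q] because the filtered
   polynomials do, and in [P] because filtering removes only terms in [P]. *)
suff fPQ m : m \in msupp f -> P m && Q m.
  rewrite [f]mpolyE scaler_suml big_seq big1 // => m /fPQ/andP[Pm Qm].
  by rewrite -mul_mpolyC -scalerA PQx ?scaler0.
have outQ (e : supp_mod (upsetU P Q) g) :
    mpoly_filter (predC P) (e : S) \in supported_in Q.
  apply/supported_inP => p /msupp_filter[/= /negPf nP pe].
  by have /supported_inP/(_ _ pe) := supp_valP e; rewrite /= nP.
have inP (e : S) : e - mpoly_filter (predC P) e \in supported_in P.
  apply/supported_inP => p; rewrite mcoeff_msupp mcoeffB mcoeff_filter /=.
  by case: (P p) => //; rewrite subrr eqxx.
have /supported_inP fQ : f \in supported_in Q.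
  by rewrite rpredB ?rpredD ?supported_inM ?outQ.
have /supported_inP fP : f \in supported_in P.
  pose e := a *: b + c.
  have -> : f = a * ((b : S) - mpoly_filter (predC P) (b : S))
      + ((c : S) - mpoly_filter (predC P) (c : S))
      - ((e : S) - mpoly_filter (predC P) (e : S)).
    rewrite /f -/e mulrBr addrACA -opprD.
    by rewrite [in RHS]opprB [RHS]addrC addrA subrK.
  by apply: rpredB (inP e); apply: rpredD (inP c); apply: supported_inM (inP b).
by move=> mf; rewrite fP ?fQ.
Qed.
HB.instance Definition _ := GRing.isLinear.Build S (supp_mod (upsetU P Q) g) E _
  supp_proj supp_proj_linear.

Lemma supp_proj_part h f : gr_part h f -> gr_part h (supp_proj f).
Proof.
move=> hf; rewrite -[h](subrK g); apply: gr_partZ => // m /msupp_filter[_]; exact: hf.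
Qed.

Definition supp_proj_hom : grhom (supp_mod (upsetU P Q) g) E :=
  GrHom (gr_fun := supp_proj) supp_proj_part.

End Proj.

(* The map to E from the ideal spanned by P and Q that vanishes on P and is
   multiplication by x on Q extends to S; y is the image of 1. *)
Lemma injective_split P Q (E : grmod R d) g (x : E) : gr_injective E -> gr_part g x ->
  (forall m, P m -> Q m -> ('X_[m] : S) *: x = 0) ->
  exists y, [/\ gr_part g y, forall m, P m -> ('X_[m] : S) *: y = 0
    & forall m, Q m -> ('X_[m] : S) *: (x - y) = 0].
Proof.
move=> injE gx PQx.
have [h hP] := injE _ _ _ (supp_proj_hom gx PQx)
  (@supp_incl_inj (upsetU P Q) (upset_full n) g (fun _ _ => isT)).
have T1 : (1 : S) \in supported_in (upset_full n) by apply/supported_inP.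
pose e1 : supp_mod (upset_full n) g := SuppCar T1.
have XPQ m : P m || Q m -> ('X_[m] : S) \in supported_in (upsetU P Q).
  by move=> PQm; apply/supported_inP => p; rewrite msuppX inE => /eqP ->.
have hX m : P m || Q m -> ('X_[m] : S) *: h e1 = if P m then 0 else ('X_[m] : S) *: x.
  move=> PQm; rewrite -linearZ.
  pose eX : supp_mod (upsetU P Q) g := SuppCar (XPQ m PQm).
  have -> : ('X_[m] : S) *: e1 =
      @supp_incl_hom (upsetU P Q) (upset_full n) g (fun _ _ => isT) eX.
    by apply: val_inj; rewrite /= mulr1.
  rewrite hP /= /supp_proj /= /mpoly_filter big_mkcond msuppX big_seq1 /=.
  by rewrite mcoeffX eqxx scale1r; case: (P m); rewrite //= scale0r.
exists (h e1); split=> [|m Pm|m Qm].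
  by apply: gr_fun_part; rewrite /= /supp_part /= subrr; exact: poly_part1.
  by rewrite hX Pm.
rewrite scalerBr hX ?Qm ?orbT //; case: ifP => Pm; last by rewrite subrr.
by rewrite PQx ?subr0.
Qed.

End Split.

(** * Mayer-Vietoris for torsion along families of supports *)

Section MayerVietoris.
Context (R : comNzRingType) (n : nat) (G : zmodType) (d : 'I_n -> G).
Local Notation S := {mpoly R[n]}.
Implicit Types (U V W : {set {set 'I_n}}).

Lemma upset_powD U k (p m : 'X_{1..n}) :
  [exists sigma in U, [forall i in sigma, k <= m i]]%N ->
  [exists sigma in U, [forall i in sigma, k <= (p + m)%MM i]]%N.
Proof.
case/exists_inP => sigma sU /forall_inP sk; apply/exists_inP; exists sigma => //.
by apply/forall_inP => i /sk ki; rewrite mnmDE; apply: leq_trans ki (leq_addl _ _).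
Qed.

(** Exponent set of the ideal generated by the [k]-th powers of the squarefree monomials with
    support in [U]. *)
Definition upset_pow U k : upset n := UpSet (@upset_powD U k).

Lemma supp_torsion_pow U k (N : grmod R d) (x : N) :
  (forall m, upset_pow U k m -> ('X_[m] : S) *: x = 0) -> supp_torsion U x.
Proof.
move=> Ux sigma sU; exists k; rewrite mpolyXn; apply: Ux.
apply/exists_inP; exists sigma => //; apply/forall_inP => i si.
by rewrite mulmnE mnmE si mul1n.
Qed.

(** There are finitely many supports, so the largest of their exponents serves for all. *)
Lemma supp_torsion_exponent U (N : grmod R d) (x : N) : supp_torsion U x ->
  exists k, forall m, upset_pow U k m -> ('X_[m] : S) *: x = 0.
Proof.
move=> Ux.
have exk : forall sigma, exists k,
    sigma \in U -> ('X_[sqfree_mnm sigma] : S) ^+ k *: x = 0.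
  by move=> sigma; have [/Ux[k xk]|_] := boolP (sigma \in U); [exists k|exists 0].
have [k kP] := choice exk; exists (\max_sigma k sigma) => m.
case/exists_inP => sigma sU /forall_inP sm.
rewrite (@mpolyX_le _ _ (sqfree_mnm sigma *+ k sigma)%MM m).
  by rewrite -scalerA -mpolyXn kP ?scaler0.
apply/mnm_lepP => i; rewrite mulmnE mnmE; case: (boolP (i \in sigma)) => // /sm.
by rewrite mul1n; apply: leq_trans; exact: (leq_bigmax sigma).
Qed.

Lemma supp_torsionB U (N : grmod R d) (x y : N) :
  supp_torsion U x -> supp_torsion U y -> supp_torsion U (x - y).
Proof.
move=> /supp_torsion_exponent[k xk] /supp_torsion_exponent[l yl].
apply: (@supp_torsion_pow U (maxn k l) N) => m /exists_inP[sigma sU /forall_inP sm].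
rewrite scalerBr xk ?yl ?subrr //; apply/exists_inP; exists sigma => //.
all: apply/forall_inP => i /sm; apply: leq_trans.
  exact: leq_maxr.
exact: leq_maxl.
Qed.

Lemma supp_torsionN U (N : grmod R d) (x : N) :
  supp_torsion U x -> supp_torsion U (- x).
Proof. by move=> Ux s /Ux[k xk]; exists k; rewrite scalerN xk oppr0. Qed.

Lemma supp_torsionS U V (N : grmod R d) : U \subset V ->
  @supp_torsion R n G d V N `<=` @supp_torsion R n G d U N.
Proof. by move=> /fintype.subsetP UV x Vx s /UV; exact: Vx. Qed.

Lemma supp_torsionU U V (N : grmod R d) (x : N) :
  supp_torsion U x -> supp_torsion V x -> supp_torsion (U :|: V) x.
Proof. by move=> Ux Vx s; rewrite inE => /orP[/Ux|/Vx]. Qed.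

Lemma supp_torsion_hom U (N N' : grmod R d) (f : grhom N N') (x : N) :
  supp_torsion U x -> supp_torsion U (f x).
Proof. by move=> Ux s /Ux[k xk]; exists k; rewrite -linearZ xk raddf0. Qed.

(** [injective_split] applies to the ideals of [k]-th powers: a monomial in both is divisible by the
    [k]-th power for some [sigma :|: tau] with [sigma] in [U] and [tau] in [V], and this union lies
    in [U :&: V] by upward closure. *)
Lemma supp_torsion_split U V (E : grmod R d) g (x : E) :
  supp_up U -> supp_up V -> gr_injective E -> gr_part g x ->
  supp_torsion (U :&: V) x ->
  exists y, [/\ gr_part g y, supp_torsion U y & supp_torsion V (x - y)].
Proof.
move=> upU upV injE gx /supp_torsion_exponent[k xk].
have [m|y [gy Uy Vy]] :=
  @injective_split _ _ _ _ (upset_pow U k) (upset_pow V k) E g x injE gx.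
  case/exists_inP => sigma sU /forall_inP sm /exists_inP[tau tV /forall_inP tm].
  apply: xk; apply/exists_inP; exists (sigma :|: tau)%SET.
    apply/setIP; split; first by apply: upU sU; exact: finset.subsetUl.
    by apply: upV tV; exact: finset.subsetUr.
  by apply/forall_inP => i; rewrite inE => /orP[/sm|/tm].
by exists y; split=> //; [exact: supp_torsion_pow Uy|exact: supp_torsion_pow Vy].
Qed.

(** * Exactness of torsion subcomplexes in a fixed degree *)

Section Strand.
Context (M : grmod R d) (E : inj_resolution M) (g : G).

Definition strand_image (P : forall N : grmod R d, set N) (i : nat) : set (ir_mod E i) :=
  match i return set (ir_mod E i) with
  | 0 => [set 0]
  | j.+1 => [set ir_diff E j y | y in [set y | P _ y /\ gr_part g y]]
  end.

(** For [P] a torsion functor, this is the vanishing of its [i]-th derived functor on [M] in degree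
    [g]. *)
Definition strand_exact (P : forall N : grmod R d, set N) (i : nat) : Prop :=
  forall x : ir_mod E i,
    P _ x -> gr_part g x -> ir_diff E i x = 0 -> strand_image P x.

Lemma ir_diff2 i x : ir_diff E i.+1 (ir_diff E i x) = 0.
Proof. by apply/ir_exactS; exists x. Qed.

Lemma strand_image_split U V W i (x y : ir_mod E i) : W \subset U -> W \subset V ->
  strand_image (supp_torsion U) y -> strand_image (supp_torsion V) (x - y) ->
  strand_image (supp_torsion W) x.
Proof.
move=> WU WV; case: i x y => [x y -> /=|i x y]; first by rewrite subr0.
move=> [a [Ua ga] ay] [b [Vb gb] bxy]; exists (a + b); last first.
  by rewrite raddfD /= ay bxy addrC subrK.
split; last exact: gr_partD.
rewrite -[b]opprK; apply: supp_torsionB; first exact: supp_torsionS Ua.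
by apply: supp_torsionN; exact: supp_torsionS Vb.
Qed.

(** A chase around the connecting map. Split [x] as [y + (x - y)]; as [x] is a cocycle,
    [dy = - d(x - y)] is torsion for both [U] and [V], hence equals [dz] with [z] torsion for both.
    Then [y - z] and [x - (y - z)] are cocycles, torsion for [U] and [V] respectively, so both are
    coboundaries. *)
Lemma mayer_vietoris U V i : supp_up U -> supp_up V ->
  strand_exact (supp_torsion U) i -> strand_exact (supp_torsion V) i ->
  strand_exact (supp_torsion (U :|: V)) i.+1 ->
  strand_exact (supp_torsion (U :&: V)) i.
Proof.
move=> upU upV exU exV exUV x UVx gx dx.
have [y [gy Uy Vxy]] := supp_torsion_split upU upV (ir_injective (k := i)) gx UVx.
have [|z [UVz gz] dz] :=
  exUV (ir_diff E i y) _ (gr_fun_part (ir_diff E i) gy) (ir_diff2 y).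
  apply: supp_torsionU; first exact: supp_torsion_hom.
  have -> : y = - (x - y - x) by rewrite addrAC subrr sub0r opprK.
  rewrite linearN raddfB /= dx subr0; apply: supp_torsionN.
  exact: supp_torsion_hom.
have Uz : supp_torsion U z by apply: supp_torsionS UVz; exact: finset.subsetUl.
have Vz : supp_torsion V z by apply: supp_torsionS UVz; exact: finset.subsetUr.
apply: (@strand_image_split U V _ _ _ (y - z)).
- exact: finset.subsetIl.
- exact: finset.subsetIr.
- by apply: exU; [exact: supp_torsionB|exact: gr_partB|rewrite raddfB /= dz subrr].
apply: exV.
- rewrite opprB addrA addrAC -[z]opprK; apply: supp_torsionB => //.
  exact: supp_torsionN.
- by do 2!apply: gr_partB => //.
- by rewrite !raddfB /= dx dz add0r addrN.
Qed.

Lemma supp_upU U V : supp_up U -> supp_up V -> supp_up (U :|: V).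
Proof.
move=> upU upV s u su; rewrite !inE => /orP[/(upU _ _ su)->//|/(upV _ _ su)->].
by rewrite orbT.
Qed.

Lemma supp_up_bigcap (I : finType) (J : {set I}) (U : I -> {set {set 'I_n}}) :
  (forall j, supp_up (U j)) -> supp_up (\bigcap_(j in J) U j)%SET.
Proof.
move=> upU s u su /bigcapP sU; apply/bigcapP => j /sU; exact: upU.
Qed.

(* Induction on #|J|, with W absorbing the members already removed from J:
   for j in J, Mayer-Vietoris for W :|: U j and W :|: \bigcap_(J :\ j) U leads
   to their union, which is the intersection of J :\ j with W :|: U j for W. *)
Lemma strand_exact_bigcap (I : finType) (U : I -> {set {set 'I_n}}) :
  (forall j, supp_up (U j)) ->
  forall (J : {set I}) W i, supp_up W ->
  (forall p (K : {set I}), K \subset J -> #|K| = p.+1 ->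
    strand_exact (supp_torsion (W :|: \bigcup_(j in K) U j)) (i + p)) ->
  strand_exact (supp_torsion (W :|: \bigcap_(j in J) U j)) i.
Proof.
move=> upU J; have [N] := ubnP #|J|; elim: N J => // N IH J JN W i upW exK.
have [->|[j jJ]] := set_0Vmem J.
  (* The empty intersection contains the empty support, whose monomial is 1, so every torsion
     element is 0. *)
  move=> x Wx _ _; have -> : x = 0.
    have [|k] := Wx finset.set0; first by rewrite inE big_set0 inE orbT.
    have -> : sqfree_mnm finset.set0 = 0%MM :> 'X_{1..n}.
      by apply/mnmP => l; rewrite mnmE inE mnm0E.
    by rewrite mpolyX0 expr1n scale1r.
  case: i {exK x Wx} => [//|i]; exists 0; last exact: raddf0.
  by split; [move=> s _; exists 0; rewrite scaler0|exact: gr_part0].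
have JjN : (#|J :\ j| < N)%N by rewrite (cardsD1 j) jJ in JN.
rewrite (big_setD1 j) //= finset.setUIr.
have upWj : supp_up (W :|: U j) by exact: supp_upU.
apply: mayer_vietoris => //.
- by apply: supp_upU => //; exact: supp_up_bigcap.
- have := exK 0 [set j]%SET; rewrite big_set1 addn0; apply; last exact: cards1.
  by rewrite finset.sub1set.
- apply: IH => // p K KJ; apply: exK.
  by apply: fintype.subset_trans KJ _; exact: subD1set.
- rewrite finset.setUACA finset.setUid finset.setUA.
  apply: IH => // p K KJ Kp; have jK : j \notin K.
    by apply: contraL jJ => /(fintype.subsetP KJ); rewrite !inE eqxx.
  (* Adjoining [j] raises the size of [K] by one, which matches the shift from [i] to [i.+1]. *)
  have := exK p.+1 (j |: K)%SET; rewrite big_setU1 // finset.setUA addnS; apply.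
    rewrite finset.subUset finset.sub1set jJ; apply: fintype.subset_trans KJ _.
    exact: subD1set.
  by rewrite cardsU1 jK Kp.
Qed.

End Strand.

(** All classes are zero exactly when each cocycle is a coboundary, and [torsion_rad_supp]
    identifies the two notions of torsion. *)
Lemma lc_vanishingP (A : set S) (M : grmod R d) g i : mnm_ideal A ->
  lc_vanishing A i M g <->
  strand_exact (injres M) g (supp_torsion (rad_supp A)) i.
Proof.
move=> mA; rewrite -torsion_rad_supp // /strand_exact.
set im := @strand_image _ _ _ _ i.
have imE : im = @coboundary _ _ _ _ A M (injres M) g i by rewrite /im; case: (i).
have pi0 x : (\pi_(Quotient.quot (@coboundary_pred _ _ _ _ A M (injres M) g i)) x)%qT = 0
    <-> im x.
  have -> : 0 = (\pi_(Quotient.quot (@coboundary_pred _ _ _ _ A M (injres M) g i)) 0)%qT.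
    by rewrite piE.
  rewrite imE; split=> [/eqP|ix]; first by rewrite -Quotient.idealrBE subr0 => /asboolP.
  by apply/eqP; rewrite -Quotient.idealrBE subr0; exact/asboolP.
split=> [lc0 x Ax gx dx|ex].
  have : @local_cohomology _ _ _ _ A i M g (\pi x)%qT by exists x.
  by move: lc0; rewrite /lc_vanishing /= => -> /pi0.
apply/seteqP; split=> [_ [x [Ax gx dx] <-]|_ ->].
  by apply/pi0; exact: ex.
(* Vanishing is an equality with [[set 0]], so the zero class must be attained. *)
exists 0; last by rewrite piE.
by split; [exact: torsion0|exact: gr_part0|exact: raddf0].
Qed.

End MayerVietoris.

(** * Vanishing degrees for a union of closed sets *)

Theorem lemma5p1 (R : comNzRingType) (n : nat) (G : zmodType) (d : 'I_n -> G)
    (t : nat) (B : set {mpoly R[n]}) (Bs : 'I_t -> set {mpoly R[n]})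
    (M : grmod R d) (i : nat) :
  noetherian R ->
  fin_gen_group G ->
  is_monomial_ideal B ->
  (forall j, is_monomial_ideal (Bs j)) ->
  vanishing B = \bigcup_(j : 'I_t) vanishing (Bs j) ->
  \bigcap_(p : nat) \bigcap_(J in [set J : {set 'I_t} | #|J| = p.+1])
      lc_vanishing (ideal_sum Bs J) (i + p)%N M
    `<=` lc_vanishing B i M.
Proof.
move=> _ _ /is_monomial_ideal_mnm mB mBs0 VB g vg.
have mBs j := is_monomial_ideal_mnm (mBs0 j).
have idBs j : is_ideal (Bs j) by case: (mBs j).
apply/(lc_vanishingP _ _ _ mB).
(* The supports for [B] are the intersection of those for the [Bs j]; the empty family joined in
   front is the initial [W] of the induction. *)
rewrite (rad_supp_vanishing mB.1 idBs VB) -[X in supp_torsion X]finset.set0U.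
apply: strand_exact_bigcap => [j||p K _ Kp]; [exact: rad_supp_up| |].
  by move=> s u _; rewrite inE.
rewrite finset.set0U -rad_supp_sum //.
by apply/lc_vanishingP; [exact: mnm_ideal_sum|exact: vg].
Qed.
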